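(* Let $s$ be even and let $A_1,\ldots,A_{s/2}\in\mathbb{R}^{n\times n}$ be symmetric matrices satisfying $\sum_{j=1}^{s/2}j^2A_j=I$. Let $U:\mathbb{R}^n\to\mathbb{R}$ be smooth and consider the linear multistep method \[\sum_{j=1}^{s/2}A_j\big(y(t-jh)-2y(t)+y(t+jh)\big)=h^2\nabla U(y(t))\] for the ODE $\ddot y=\nabla U(y)$, with its modified equation $\ddot y=\nabla U(y)+\sum_{i=1}^N h^i g_i(y,\dot y)+\mathcal{O}(h^{N+1})$, where $N\in\mathbb{N}$ is the considered order of the series expansion. Let $z=(y,\dot y)$, $H(z)=\frac12\|\dot y\|^2-U(y)$ and $J=\begin{pmatrix}0&-I\\ I&0\end{pmatrix}$. Then there exist a modified symplectic structure $J^{[N]}_{\mathrm{mod}}$ which is $\mathcal{O}(h)$-close to $J$ and a modified Hamiltonian $H^{[N]}_{\mathrm{mod}}$ which is $\mathcal{O}(h)$-close to $H$ such that \[\dot z(t)=\big(J^{[N]}_{\mathrm{mod}}(z)\big)^{-1}\nabla H^{[N]}_{\mathrm{mod}}(z(t))\] is equivalent to the modified equation up to terms of order $\mathcal{O}(h^{N+1})$.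
   Context: $h$ is treated as a formal variable. The modified equation is obtained as follows: Taylor-expanding $y(t\pm jh)$ in the multistep formula in powers of $h$ and using $\sum_j j^2A_j=I$ yields an expression $\ddot y=\nabla U(y)+\sum_{i=1}^N h^i\tilde g_i(y,\dot y,\ldots,y^{(a_i)})+\mathcal{O}(h^{N+1})$ with $h$-independent $\tilde g_i$; iteratively replacing third and higher derivatives of $y$ on the right-hand side by derivatives of this expression itself gives $\ddot y=\nabla U(y)+\sum_{i=1}^N h^i g_i(y,\dot y)+\mathcal{O}(h^{N+1})$. $J^{[N]}_{\mathrm{mod}}$ and $H^{[N]}_{\mathrm{mod}}$ are polynomials in $h$ of degree at most $N$ whose coefficients are functions of $z$; $J^{[N]}_{\mathrm{mod}}$ is a skew-symmetric matrix-valued function representing a closed 2-form (symplectic structure). ''$\mathcal{O}(h)$-close to $J$'' means the zeroth coefficient of $J^{[N]}_{\mathrm{mod}}$ in $h$ equals $J$; analogously for $H$. *)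

(* Defs.v *)
From HB Require Import structures.
From mathcomp Require Import all_boot all_order all_algebra.
From mathcomp Require Import all_classical all_reals all_analysis.
Set Implicit Arguments. Unset Strict Implicit. Unset Printing Implicit Defensive.
Import Order.TTheory GRing.Theory Num.Theory.
Import numFieldNormedType.Exports.
Local Open Scope ring_scope.

Section Defs.
Variable R : realType.

Fixpoint iterD (V W : normedModType R) (vs : seq V) (f : V -> W) : V -> W :=
  match vs with
  | [::] => f
  | v :: vs' => fun x => derive (iterD vs' f) x v
  end.

Definition smooth (V W : normedModType R) (f : V -> W) : Prop :=
  forall (vs : seq V) (x : V), differentiable (iterD vs f) x.

Definition ev (n : nat) (i : 'I_n) : 'rV[R]_n := delta_mx 0 i.

Definition grad (n : nat) (f : 'rV[R]_n -> R) (x : 'rV[R]_n) : 'rV[R]_n :=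
  \row_i derive f x (ev i).

Definition mxv (n : nat) (M : 'M[R]_n) (x : 'rV[R]_n) : 'rV[R]_n := (M *m x^T)^T.

Definition Jcan (n : nat) : 'M[R]_(n + n) := block_mx 0 (- 1%:M) 1%:M 0.

Definition Ham (n : nat) (U : 'rV[R]_n -> R) (z : 'rV[R]_(n + n)) : R :=
  2^-1 * (\sum_i (rsubmx z 0 i) ^+ 2) - U (lsubmx z).

(* ---- The modified equation ----
   Coefficients of the modified force F_h = grad U + sum_{i>=1} h^i g_i.
   [Fc U g r] is the coefficient of h^r (r = 0: grad U(y); r >= 1: g r). *)
Definition Fc (n : nat) (U : 'rV[R]_n -> R) (g : nat -> 'rV[R]_(n + n) -> 'rV[R]_n)
  (r : nat) (z : 'rV[R]_(n + n)) : 'rV[R]_n :=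
  if r == 0%N then grad U (lsubmx z) else g r z.

(* [Dc U g m r] = coefficient of h^r of the m-th time derivative y^(m),
   expressed as a function of z = (y, ydot) along the modified flow
   ydot' = F_h(y,ydot): D_0 = y, D_1 = ydot, D_{m+1} = L_F D_m with
   L_F phi (z) = D_{(ydot, F_h(z))} phi (z), expanded in powers of h. *)
Fixpoint Dc (n : nat) (U : 'rV[R]_n -> R) (g : nat -> 'rV[R]_(n + n) -> 'rV[R]_n)
  (m : nat) : nat -> 'rV[R]_(n + n) -> 'rV[R]_n :=
  match m with
  | 0%N => fun r z => if r == 0%N then lsubmx z else 0
  | 1%N => fun r z => if r == 0%N then rsubmx z else 0
  | m'.+1 => fun r z =>
      derive (Dc U g m' r) z (row_mx (rsubmx z) 0)
      + \sum_(a < r.+1) derive (Dc U g m' (r - a)) z (row_mx 0 (Fc U g a z))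
  end.

Definition Bk (n s : nat) (A : nat -> 'M[R]_n) (k : nat) : 'M[R]_n :=
  \sum_(1 <= j < (s./2).+1) (j ^ (2 * k))%:R *: A j.

(* Taylor expansion of the multistep formula divided by h^2, using
   sum j^2 A_j = I:
     ydd = grad U(y) - sum_{k>=2} 2/(2k)! h^(2k-2) B_k y^(2k).
   Coefficient of h^i (i >= 1), given the already known g_1..g_{i-1}. *)
Definition grhs (n s : nat) (A : nat -> 'M[R]_n) (U : 'rV[R]_n -> R)
  (g : nat -> 'rV[R]_(n + n) -> 'rV[R]_n) (i : nat) (z : 'rV[R]_(n + n))
  : 'rV[R]_n :=
  - \sum_(2 <= k < i./2.+2)
      ((2%:R / ((2 * k)`!)%:R) *: mxv (Bk s A k) (Dc U g (2 * k) (i - (2 * k - 2)) z)).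

Fixpoint gtab (n s : nat) (A : nat -> 'M[R]_n) (U : 'rV[R]_n -> R) (K : nat)
  : nat -> 'rV[R]_(n + n) -> 'rV[R]_n :=
  match K with
  | 0%N => fun _ _ => 0
  | K'.+1 => fun i => if i == K'.+1 then grhs s A U (gtab s A U K') i
                      else gtab s A U K' i
  end.

Definition gmod (n s : nat) (A : nat -> 'M[R]_n) (U : 'rV[R]_n -> R) (i : nat)
  : 'rV[R]_(n + n) -> 'rV[R]_n := gtab s A U i i.

Definition Fmod (n s : nat) (A : nat -> 'M[R]_n) (U : 'rV[R]_n -> R) (N : nat)
  (h : R) (z : 'rV[R]_(n + n)) : 'rV[R]_(n + n) :=
  row_mx (rsubmx z)
         (grad U (lsubmx z) + \sum_(1 <= i < N.+1) h ^+ i *: gmod s A U i z).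

Definition closed_form (n : nat) (J : 'rV[R]_n -> 'M[R]_n) : Prop :=
  forall (z : 'rV[R]_n) (a b c : 'I_n),
    derive (fun w => J w b c) z (ev a) + derive (fun w => J w c a) z (ev b)
    + derive (fun w => J w a b) z (ev c) = 0.

Definition skew_field (n : nat) (J : 'rV[R]_n -> 'M[R]_n) : Prop :=
  forall z, (J z)^T = - J z.

End Defs.

(* Main.v *)
(* The multistep formula is, after division by [h^2], the formal higher-order
   Euler-Lagrange equation  sum_k c_k h^(2k-2) B_k y^(2k) = grad U(y)  with
   c_k = 2/(2k)!  and B_k = sum_j j^(2k) A_j symmetric.  Let D_m(z) be the
   series in [h] giving y^(m) along the modified flow X, so that X D_m = D_(m+1).
   The Ostrogradsky form pulled back to z = (y, y'),
     omega = sum_k c_k h^(2k-2) sum_(i<k) (-1)^i dD_i^T B_k /\ dD_(2k-1-i),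
   is closed, being a combination of products of exact forms, and starts with
   dy /\ dy'.  Contracting with X, the sum over i telescopes to exact terms and
   - dy^T sum_k c_k h^(2k-2) B_k D_(2k) = - dU, so  i_X omega = dH  with
     H = - U + sum_k c_k h^(2k-2) (- sum_(0<j<k) (-1)^j D_j^T B_k D_(2k-j)
                                    - 1/2 (-1)^k D_k^T B_k D_k).
   Omega and H truncated at order N are the required objects.  Series in [h] are
   represented by polynomials modulo 'X^(N+1). *)

Require Import Defs.
From HB Require Import structures.
From mathcomp Require Import all_boot all_order all_algebra.
From mathcomp Require Import all_classical all_reals all_analysis.
From mathcomp Require Import zify ring lra.
Import Order.TTheory GRing.Theory Num.Theory.
Import numFieldNormedType.Exports.
Local Open Scope ring_scope.
Set Implicit Arguments. Unset Strict Implicit. Unset Printing Implicit Defensive.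

(** * Smooth functions *)

Section SmoothGeneral.
Context {R : realType}.
Implicit Types V W : normedModType R.

Lemma iterD_rcons V W (vs : seq V) v (f : V -> W) :
  Defs.iterD (rcons vs v) f = Defs.iterD vs (fun x => 'D_v f x).
Proof. by elim: vs => [|u vs IH] //=; rewrite IH. Qed.

(** Coinduction: a closure property of [smooth] follows from a class of differentiable functions
    stable under directional derivatives. [iterD] takes the last listed derivative first, hence the
    induction from the end of the list. *)
Lemma smooth_coind V W (P : (V -> W) -> Prop) :
  (forall f, P f -> (forall x, differentiable f x) /\
                    forall v, P (fun x => 'D_v f x)) ->
  forall f, P f -> smooth f.
Proof.
move=> H f Pf vs; elim/last_ind: vs f Pf => [|vs v IH] f /H[df dP] x //=.
by rewrite iterD_rcons; apply: IH.
Qed.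

Lemma smooth_diff V W (f : V -> W) x : smooth f -> differentiable f x.
Proof. by move=> /(_ [::]). Qed.

Lemma smooth_derivable V W (f : V -> W) x v : smooth f -> derivable f x v.
Proof. by move=> sf; apply/diff_derivable/smooth_diff. Qed.

Lemma smooth_derive V W (f : V -> W) v : smooth f -> smooth (fun x => 'D_v f x).
Proof. by move=> sf vs x; rewrite -iterD_rcons; apply: sf. Qed.

Lemma smooth_cst V W (c : W) : smooth (fun _ : V => c).
Proof.
apply: (@smooth_coind _ _ (fun f => exists c, f = fun _ => c)); last by exists c.
move=> _ [{}c ->]; split; first by move=> x; exact: differentiable_cst.
by move=> v; exists 0; apply/funext => x; exact: derive_cst.
Qed.

Lemma smoothD V W (f g : V -> W) :
  smooth f -> smooth g -> smooth (fun x => f x + g x).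
Proof.
move=> sf sg; apply: (@smooth_coind _ _ (fun h => exists f g,
  [/\ smooth f, smooth g & h = (fun x => f x + g x)])); last by exists f, g.
move=> _ [{sf}f [{sg}g [sf sg ->]]]; split.
  by move=> x; apply: differentiableD; exact: smooth_diff.
move=> v; exists (fun x => 'D_v f x), (fun x => 'D_v g x).
split; [exact: smooth_derive | exact: smooth_derive |].
by apply/funext => x; apply: deriveD; exact: smooth_derivable.
Qed.

Lemma smooth_sum V W I (r : seq I) (P : pred I) (F : I -> V -> W) :
  (forall i, P i -> smooth (F i)) -> smooth (fun x => \sum_(i <- r | P i) F i x).
Proof.
move=> sF; elim: r => [|i r IH].
  have -> : (fun x => \sum_(i <- [::] | P i) F i x) = (fun=> 0).
    by apply/funext => x; rewrite big_nil.
  exact: smooth_cst.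
have -> : (fun x => \sum_(j <- i :: r | P j) F j x) =
  (fun x => (if P i then F i x else 0) + \sum_(j <- r | P j) F j x).
  by apply/funext => x; rewrite big_cons; case: ifP; rewrite ?add0r.
by apply: smoothD => //; case: (P i) (sF i)  => sFi; [exact: sFi|exact: smooth_cst].
Qed.

Lemma derive_lin V W W' (L : {linear W -> W'}) (f : V -> W) x v :
  continuous L -> differentiable f x ->
  'D_v (fun x => L (f x)) x = L ('D_v f x).
Proof.
move=> cL df; have dL y : differentiable L y by exact: linear_differentiable.
rewrite !deriveE //; last exact: differentiable_comp.
by rewrite (@diff_comp _ _ _ _ f L) // diff_lin.
Qed.

Lemma smooth_lin V W W' (L : {linear W -> W'}) (f : V -> W) :
  continuous L -> smooth f -> smooth (fun x => L (f x)).
Proof.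
move=> cL sf; apply: (@smooth_coind _ _ (fun h => exists2 f,
  smooth f & h = (fun x => L (f x)))); last by exists f.
move=> _ [{sf}f sf ->]; split.
  move=> x; apply: (@differentiable_comp _ _ _ _ f L); first exact: smooth_diff.
  exact: linear_differentiable.
move=> v; exists (fun x => 'D_v f x); first exact: smooth_derive.
by apply/funext => x; apply: derive_lin => //; exact: smooth_diff.
Qed.

Lemma derive_comp_lin V V' W (L : {linear V' -> V}) (f : V -> W) x v :
  continuous L -> differentiable f (L x) ->
  'D_v (fun x => f (L x)) x = 'D_(L v) f (L x).
Proof.
move=> cL df; have dL y : differentiable L y by exact: linear_differentiable.
rewrite !deriveE //; last exact: differentiable_comp.
by rewrite (@diff_comp _ _ _ _ L f) //= diff_lin.
Qed.

Lemma smooth_comp_lin V V' W (L : {linear V' -> V}) (f : V -> W) :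
  continuous L -> smooth f -> smooth (fun x => f (L x)).
Proof.
move=> cL sf; apply: (@smooth_coind _ _ (fun h => exists2 f,
  smooth f & h = (fun x => f (L x)))); last by exists f.
move=> _ [{sf}f sf ->]; split.
  move=> x; apply: (@differentiable_comp _ _ _ _ L f); last exact: smooth_diff.
  exact: linear_differentiable.
move=> v; exists (fun x => 'D_(L v) f x); first exact: smooth_derive.
by apply/funext => x; apply: derive_comp_lin => //; exact: smooth_diff.
Qed.

(* Derivatives of a product leave the products but stay among their sums, which
   is what the coinduction for [smoothM] needs. *)
Inductive prod_closure V (P : (V -> R) -> Prop) : (V -> R) -> Prop :=
| Prod_closure_mul f g : P f -> P g -> prod_closure P (fun x => f x * g x)
| Prod_closure_add f g : prod_closure P f -> prod_closure P g ->
    prod_closure P (fun x => f x + g x).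

Lemma smoothM V (f g : V -> R) :
  smooth f -> smooth g -> smooth (fun x => f x * g x).
Proof.
move=> sf sg; apply: (@smooth_coind _ _ (prod_closure (@smooth R V R)));
  last exact: Prod_closure_mul.
move=> h; elim=> [{sf}f {sg}g sf sg|{sf}f {sg}g _ [df Pf] _ [dg Pg]]; split.
- by move=> x; apply: differentiableM; exact: smooth_diff.
- move=> v; have -> : (fun x => 'D_v (fun y => f y * g y) x) =
     (fun x => f x * 'D_v g x + g x * 'D_v f x).
    by apply/funext => x; rewrite deriveM //; exact: smooth_derivable.
  by apply: Prod_closure_add; apply: Prod_closure_mul => //; exact: smooth_derive.
- by move=> x; exact: differentiableD.
- move=> v; have -> : (fun x => 'D_v (fun y => f y + g y) x) =
     (fun x => 'D_v f x + 'D_v g x).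
    by apply/funext => x; rewrite deriveD //; exact: diff_derivable.
  exact: Prod_closure_add.
Qed.

Lemma smoothMl V (f : V -> R) (c : R) : smooth f -> smooth (fun x => c * f x).
Proof. by move=> sf; apply: smoothM => //; exact: smooth_cst. Qed.

Lemma smoothN V (f : V -> R) : smooth f -> smooth (fun x => - f x).
Proof.
move=> /(smoothMl (-1)); congr smooth.
by apply/funext => x; rewrite mulN1r.
Qed.

(** Both directions come from [smooth_lin]: reading an entry and scaling an elementary matrix are
    continuous linear maps. *)
Lemma smooth_mxP V m n (f : V -> 'M[R]_(m, n)) :
  smooth f <-> forall i j, smooth (fun x => f x i j).
Proof.
split=> [sf i j|sf].
  have lin : linear (fun M : 'M[R]_(m, n) => M i j : R).
    by move=> a u v; rewrite !mxE.
  pose LM := GRing.isLinear.Build _ _ _ _ _ lin.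
  pose L : {linear 'M[R]_(m, n) -> R} := HB.pack (fun M : 'M[R]_(m, n) => M i j) LM.
  by apply: (@smooth_lin _ _ _ L) => //; exact: coord_continuous.
have -> : f = (fun x => \sum_i \sum_j f x i j *: delta_mx i j).
  by apply/funext => x; rewrite -matrix_sum_delta.
apply: smooth_sum => i _; apply: smooth_sum => j _.
have lin : linear (fun a : R => a *: (delta_mx i j : 'M[R]_(m, n))).
  by move=> a u v; rewrite scalerDl scalerA.
pose LM := GRing.isLinear.Build _ _ _ _ _ lin.
pose L : {linear R -> 'M[R]_(m, n)} := HB.pack (fun a : R => a *: (delta_mx i j : 'M[R]_(m, n))) LM.
by apply: (@smooth_lin _ _ _ L) => //; exact: scalel_continuous.
Qed.

Lemma derive_entry V m n (f : V -> 'M[R]_(m, n)) x v i j :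
  smooth f -> ('D_v f x) i j = 'D_v (fun y => f y i j) x.
Proof. by move=> sf; rewrite derive_mx ?mxE //; exact: smooth_derivable. Qed.

Lemma derive_row_sum W m (f : 'rV[R]_m -> W) x v :
  smooth f -> 'D_v f x = \sum_e v 0 e *: 'D_(ev R e) f x.
Proof.
move=> sf; rewrite deriveE; last exact: smooth_diff.
rewrite {1}[v]row_sum_delta linear_sum; apply: eq_bigr => e _.
by rewrite linearZ deriveE //; exact: smooth_diff.
Qed.

(** The direction moves with the point, beyond the reach of [smooth_derive]; expanding it in the
    standard basis leaves fixed directions with smooth coefficients. *)
Lemma smooth_derive_along m (f : 'rV[R]_m -> R) (w : 'rV[R]_m -> 'rV[R]_m) :
  smooth f -> smooth w -> smooth (fun x => 'D_(w x) f x).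
Proof.
move=> sf /smooth_mxP sw.
have -> : (fun x => 'D_(w x) f x) = fun x => \sum_e w x 0 e * 'D_(ev R e) f x.
  by apply/funext => x; rewrite derive_row_sum.
by apply: smooth_sum => e _; apply: smoothM => //; exact: smooth_derive.
Qed.

End SmoothGeneral.

(** * Symmetry of second derivatives *)

Section Schwarz.
Context {R : realType}.
Variables (V : normedModType R) (f : V -> R).
Hypothesis sf : smooth f.

Lemma is_derive_line (g : V -> R) (y u : V) (t : R) :
  smooth g -> is_derive t 1 (fun t => g (t *: u + y)) ('D_u g (t *: u + y)).
Proof.
move=> sg; have E : (fun h : R => h^-1 *: (g ((h *: 1 + t) *: u + y) - g (t *: u + y)))
   = (fun h : R => h^-1 *: (g (h *: u + (t *: u + y)) - g (t *: u + y))).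
  by apply/funext => h; rewrite [h *: 1]mulr1 scalerDl addrA.
split; last by rewrite /derive /= E.
by rewrite /derivable /= E; exact: (@smooth_derivable _ _ _ g (t *: u + y) u sg).
Qed.

(** The mean value theorem twice: along [u] for the increment of [f] in the direction [v], then
    along [v] for the derivative ['D_u f]. *)
Lemma second_difference (x u v : V) (h : R) : 0 < h ->
  exists t s : R, [/\ 0 < t < h, 0 < s < h &
    f (h *: u + h *: v + x) - (f (h *: u + x) + f (h *: v + x)) + f x =
      h * h * 'D_v (fun y => 'D_u f y) (t *: u + s *: v + x)].
Proof.
move=> h0; pose phi (t : R) : R := f (t *: u + (h *: v + x)) - f (t *: u + x).
pose dphi (t : R) : R := 'D_u f (t *: u + (h *: v + x)) - 'D_u f (t *: u + x).
have dP (t : R) : is_derive t 1 phi (dphi t).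
  by apply: is_deriveB; exact: is_derive_line.
have cphi : {within `[0, h], continuous phi}%classic.
  by apply: derivable_within_continuous => t _; case: (dP t).
have [t] := MVT h0 (fun t _ => dP t) cphi.
rewrite in_itv /= subr0 => th Ht.
have sD : smooth (fun y => 'D_u f y) by exact: smooth_derive.
pose psi (s : R) : R := 'D_u f (s *: v + (t *: u + x)).
pose dpsi (s : R) : R := 'D_v (fun y => 'D_u f y) (s *: v + (t *: u + x)).
have dP' (s : R) : is_derive s 1 psi (dpsi s) by exact: is_derive_line.
have cpsi : {within `[0, h], continuous psi}%classic.
  by apply: derivable_within_continuous => s _; case: (dP' s).
have [s] := MVT h0 (fun s _ => dP' s) cpsi.
rewrite in_itv /= subr0 => sh Hs; exists t, s; split => //.
have -> : t *: u + s *: v + x = s *: v + (t *: u + x) by rewrite addrCA addrA.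
rewrite mulrAC -mulrA [_ * h]mulrC -/(dpsi s) [h * dpsi s]mulrC -Hs.
have -> : psi h - psi 0 = dphi t.
  by rewrite /psi /dphi scale0r add0r addrCA.
rewrite mulrC -Ht /phi scale0r !add0r !addrA; lra.
Qed.

(** By [second_difference] both mixed derivatives take the same value, one second difference over
    [h * h], at points arbitrarily near [x]. Continuity at [x] then forbids them to differ there. *)
Lemma schwarz (x u v : V) :
  'D_u (fun y => 'D_v f y) x = 'D_v (fun y => 'D_u f y) x.
Proof.
set G := fun y => 'D_v (fun z => 'D_u f z) y.
set H := fun y => 'D_u (fun z => 'D_v f z) y; rewrite -/(G x) -/(H x).
have cG : {for x, continuous G}.
  apply: differentiable_continuous; apply: smooth_diff.
  exact: smooth_derive (smooth_derive _ sf).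
have cH : {for x, continuous H}.
  apply: differentiable_continuous; apply: smooth_diff.
  exact: smooth_derive (smooth_derive _ sf).
apply/eqP/negPn/negP => GH.
pose e := `|H x - G x| / 2.
have e0 : 0 < e by rewrite divr_gt0 // normr_gt0 subr_eq0.
move/cvgrPdist_lt: cG => /(_ e e0) nG.
move/cvgrPdist_lt: cH => /(_ e e0) nH.
have nGH : nbhs x (fun y => `|G x - G y| < e /\ `|H x - H y| < e) by exact: filterI nG nH.
move/nbhs_ballP: nGH => [d /= d0 near_x].
(* This size keeps [t *: u + s *: v + x] within [d] of [x] for [t] and [s] between 0 and [h]; the 1
   keeps the denominator positive. *)
pose h := d / (`|u| + `|v| + 1).
have k0 : 0 < `|u| + `|v| + 1 by rewrite ltr_wpDl // addr_ge0.
have h0 : 0 < h by rewrite divr_gt0.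
have near_h t s : 0 < t < h -> 0 < s < h -> ball x d (t *: u + s *: v + x).
  move=> /andP[t0 th] /andP[s0 sh]; rewrite -ball_normE /ball_ /= opprD addrCA subrr addr0 normrN.
  rewrite (le_lt_trans (ler_normD _ _)) // !normrZ !gtr0_norm //.
  have -> : d = h * (`|u| + `|v| + 1) by rewrite divfK // gt_eqF.
  have := normr_ge0 u; have := normr_ge0 v; nra.
have [t [s [th sh E]]] := second_difference x u v h0.
have [s' [t' [sh' th' E']]] := second_difference x v u h0.
have [Gy _] := near_x _ (near_h t s th sh).
have := near_h t' s' th' sh'; rewrite [t' *: u + _]addrC => /near_x[_ Hy].
have hh : h * h != 0 by rewrite mulf_neq0 // gt_eqF.
have GHy : G (t *: u + s *: v + x) = H (s' *: v + t' *: u + x).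
  apply: (mulfI hh); rewrite /G /H.
  apply: etrans (esym E) _; apply: etrans _ E'.
  by rewrite [h *: v + h *: u]addrC [f (h *: u + x) + _]addrC.
have tri (a b c : R) : `|a - c| < e -> `|b - c| < e -> `|b - a| < e + e.
  move=> ac bc; apply: le_lt_trans (ler_distD c b a) _.
  by apply: ltrD bc _; rewrite distrC.
rewrite GHy in Gy; have := tri _ _ _ Gy Hy.
by rewrite /e -splitr ltxx.
Qed.
End Schwarz.

(** * Polynomials modulo 'X^K and their partial derivatives *)

Section TruncatedCongruence.
Context {R : comNzRingType}.
Variable K : nat.

Definition eqX (p q : {poly R}) := forall r, (r < K)%N -> p`_r = q`_r.

Lemma eqX_refl p : eqX p p. Proof. by []. Qed.

Lemma eq_eqX p q : p = q -> eqX p q. Proof. by move=> ->. Qed.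

Lemma eqX_sym p q : eqX p q -> eqX q p.
Proof. by move=> pq r rK; rewrite pq. Qed.

Lemma eqX_trans q p u : eqX p q -> eqX q u -> eqX p u.
Proof. by move=> pq qu r rK; rewrite pq // qu. Qed.

Lemma eqXD p p' q q' : eqX p p' -> eqX q q' -> eqX (p + q) (p' + q').
Proof. by move=> pp qq r rK; rewrite !coefD pp // qq. Qed.

Lemma eqXN p q : eqX p q -> eqX (- p) (- q).
Proof. by move=> pq r rK; rewrite !coefN pq. Qed.

Lemma eqXB p p' q q' : eqX p p' -> eqX q q' -> eqX (p - q) (p' - q').
Proof. by move=> pp qq; apply: eqXD => //; exact: eqXN. Qed.

Lemma eqXM p p' q q' : eqX p p' -> eqX q q' -> eqX (p * q) (p' * q').
Proof.
move=> pp qq r rK; rewrite !coefM; apply: eq_bigr => -[j jr] _ /=.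
rewrite ltnS in jr; rewrite (pp _ (leq_ltn_trans jr rK)).
by rewrite (qq _ (leq_ltn_trans (leq_subr _ _) rK)).
Qed.

Lemma eqXMl (c p q : {poly R}) : eqX p q -> eqX (c * p) (c * q).
Proof. exact: eqXM (eqX_refl c). Qed.

Lemma eqX_sum I (r : seq I) (P : pred I) (F G : I -> {poly R}) :
  (forall i, P i -> eqX (F i) (G i)) ->
  eqX (\sum_(i <- r | P i) F i) (\sum_(i <- r | P i) G i).
Proof.
by move=> FG; elim/big_ind2: _ => // *; exact: eqXD.
Qed.

Lemma eqX_mull0 (c p : {poly R}) : eqX p 0 -> eqX (c * p) 0.
Proof. by move=> /(eqXMl c); rewrite mulr0. Qed.

Lemma eqX_sum0 I (r : seq I) (P : pred I) (F : I -> {poly R}) :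
  (forall i, P i -> eqX (F i) 0) -> eqX (\sum_(i <- r | P i) F i) 0.
Proof.
move=> F0; elim/big_ind: _ => // p q p0 q0.
by rewrite -[0]addr0; exact: eqXD.
Qed.

(** The bilinear form u^T B v. Vectors are functions of the coordinate so that each coordinate can
    be differentiated by itself. *)
Definition pform n (B : 'M[R]_n) (u v : 'I_n -> {poly R}) : {poly R} :=
  \sum_p \sum_q (B p q)%:P * (u p * v q).

Lemma eqX_pform n (B : 'M[R]_n) (u u' v v' : 'I_n -> {poly R}) :
  (forall p, eqX (u p) (u' p)) -> (forall p, eqX (v p) (v' p)) ->
  eqX (pform B u v) (pform B u' v').
Proof.
move=> uu vv; apply: eqX_sum => p _; apply: eqX_sum => q _.
by apply: eqXMl; exact: eqXM.
Qed.

Lemma pformC n (B : 'M[R]_n) u v : B^T = B -> pform B u v = pform B v u.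
Proof.
move=> sB; rewrite /pform exchange_big /=; apply: eq_bigr => p _.
by apply: eq_bigr => q _; rewrite -{1}sB mxE [u q * _]mulrC.
Qed.

Lemma pform_suml n m (B : 'M[R]_n) (u : 'I_m -> 'I_n -> {poly R}) v X :
  \sum_a pform B (u a) v * X a = pform B (fun p => \sum_a u a p * X a) v.
Proof.
under eq_bigr do rewrite mulr_suml; rewrite exchange_big /=.
apply: eq_bigr => p _; under eq_bigr do rewrite mulr_suml.
rewrite exchange_big /=; apply: eq_bigr => q _.
by rewrite mulr_suml mulr_sumr; apply: eq_bigr => a _; ring.
Qed.

Lemma pform_sumr n m (B : 'M[R]_n) u (v : 'I_m -> 'I_n -> {poly R}) X :
  \sum_a pform B u (v a) * X a = pform B u (fun p => \sum_a v a p * X a).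
Proof.
under eq_bigr do rewrite mulr_suml; rewrite exchange_big /=.
apply: eq_bigr => p _; under eq_bigr do rewrite mulr_suml.
rewrite exchange_big /=; apply: eq_bigr => q _.
by rewrite !mulr_sumr; apply: eq_bigr => a _; ring.
Qed.

End TruncatedCongruence.

(** * Coefficientwise differential calculus of polynomial-valued functions *)

Section PolyCalculus.
Context {R : realType}.
Variables (K : nat) (V : normedModType R).
Implicit Types (f g : V -> {poly R}) (v : V).
Local Notation eqX := (@eqX R K).

Definition psmooth f : Prop := forall r, smooth (fun x => (f x)`_r).

(** The degree of [f x] need not be bounded uniformly in [x], so the cut at [K] is what makes the
    coefficientwise derivative a polynomial. The product rule then holds modulo ['X^K]. *)
Definition pder v f x : {poly R} := \poly_(r < K) 'D_v (fun y => (f y)`_r) x.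

Lemma coef_pder v f x r :
  (r < K)%N -> (pder v f x)`_r = 'D_v (fun y => (f y)`_r) x.
Proof. by move=> rK; rewrite coef_poly rK. Qed.

Lemma eq_derive (f g : V -> R) v x : f =1 g -> 'D_v f x = 'D_v g x.
Proof. by move=> /funext ->. Qed.

Lemma eq_pder v f g x : f =1 g -> pder v f x = pder v g x.
Proof. by move=> /funext ->. Qed.

Lemma psmooth_cst c : psmooth (fun _ => c).
Proof. by move=> r; exact: smooth_cst. Qed.

Lemma psmoothC (f : V -> R) : smooth f -> psmooth (fun x => (f x)%:P).
Proof.
move=> sf [|r]; last first.
  by move: (smooth_cst (V := V) (0 : R)); congr smooth; apply/funext => x; rewrite coefC.
by move: sf; congr smooth; apply/funext => x; rewrite coefC.
Qed.

Lemma psmoothD f g : psmooth f -> psmooth g -> psmooth (fun x => f x + g x).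
Proof.
move=> sf sg r; move: (smoothD (sf r) (sg r)); congr smooth.
by apply/funext => x; rewrite coefD.
Qed.

Lemma psmoothM f g : psmooth f -> psmooth g -> psmooth (fun x => f x * g x).
Proof.
move=> sf sg r.
have -> : (fun x => (f x * g x)`_r) =
    (fun x => \sum_(j < r.+1) (f x)`_j * (g x)`_(r - j)).
  by apply/funext => x; rewrite coefM.
by apply: smooth_sum => j _; exact: smoothM.
Qed.

Lemma psmoothMl c f : psmooth f -> psmooth (fun x => c * f x).
Proof. by apply: psmoothM; exact: psmooth_cst. Qed.

Lemma psmoothN f : psmooth f -> psmooth (fun x => - f x).
Proof.
move=> /(psmoothMl (-1)); congr psmooth.
by apply/funext => x; rewrite mulN1r.
Qed.

Lemma psmoothB f g : psmooth f -> psmooth g -> psmooth (fun x => f x - g x).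
Proof. by move=> sf sg; apply: psmoothD => //; exact: psmoothN. Qed.

Lemma psmooth_sum I (r : seq I) (P : pred I) (F : I -> V -> {poly R}) :
  (forall i, P i -> psmooth (F i)) -> psmooth (fun x => \sum_(i <- r | P i) F i x).
Proof.
move=> sF k; have -> : (fun x => (\sum_(i <- r | P i) F i x)`_k) =
    (fun x => \sum_(i <- r | P i) (F i x)`_k).
  by apply/funext => x; rewrite coef_sum.
by apply: smooth_sum => i Pi; exact: sF.
Qed.

Lemma psmooth_pform n (B : 'M[R]_n) (F G : V -> 'I_n -> {poly R}) :
  (forall p, psmooth (F ^~ p)) -> (forall p, psmooth (G ^~ p)) ->
  psmooth (fun x => pform B (F x) (G x)).
Proof.
move=> sF sG; apply: psmooth_sum => p _; apply: psmooth_sum => q _.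
by apply: psmoothMl; exact: psmoothM.
Qed.

Lemma psmooth_pder v f : psmooth f -> psmooth (pder v f).
Proof.
move=> sf r; have [rK|Kr] := ltnP r K.
  have -> : (fun x => (pder v f x)`_r) = (fun x => 'D_v (fun y => (f y)`_r) x).
    by apply/funext => x; rewrite coef_pder.
  exact: smooth_derive.
have -> : (fun x => (pder v f x)`_r) = (fun x => 0).
  by apply/funext => x; rewrite coef_poly ltnNge Kr.
exact: smooth_cst.
Qed.

Lemma pder_cst v c x : pder v (fun _ => c) x = 0.
Proof. by apply/polyP => r; rewrite coef_poly coef0 derive_cst if_same. Qed.

Lemma pderD v f g x : psmooth f -> psmooth g ->
  pder v (fun y => f y + g y) x = pder v f x + pder v g x.
Proof.
move=> sf sg; apply/polyP => r; rewrite coefD !coef_poly.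
case: ifP => rK; last by rewrite addr0.
rewrite -deriveD; [|exact: smooth_derivable|exact: smooth_derivable].
by apply: eq_derive => y; rewrite coefD.
Qed.

Lemma pder_sum I (r : seq I) (P : pred I) (F : I -> V -> {poly R}) v x :
  (forall i, psmooth (F i)) ->
  pder v (fun y => \sum_(i <- r | P i) F i y) x =
  \sum_(i <- r | P i) pder v (F i) x.
Proof.
move=> sF; elim: r => [|i r IH].
  rewrite big_nil; apply: etrans (pder_cst v 0 x).
  by apply: eq_pder => y; rewrite big_nil.
have -> : (fun y => \sum_(j <- i :: r | P j) F j y) =
    (fun y => (if P i then F i y else 0) + \sum_(j <- r | P j) F j y).
  by apply/funext => y; rewrite big_cons; case: ifP; rewrite ?add0r.
rewrite pderD; last by apply: psmooth_sum.
  rewrite IH big_cons; case: ifP => // _.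
  by rewrite pder_cst add0r.
by case: (P i) => //; exact: psmooth_cst.
Qed.

Lemma pderM v f g x : psmooth f -> psmooth g ->
  eqX (pder v (fun y => f y * g y) x) (pder v f x * g x + f x * pder v g x).
Proof.
move=> sf sg r rK; rewrite coef_pder // coefD !coefM -big_split /=.
have -> : (fun y => (f y * g y)`_r) =
    \sum_(j < r.+1) (fun y => (f y)`_j * (g y)`_(r - j)).
  by apply/funext => y; rewrite coefM fct_sumE.
rewrite derive_sum => [|j]; last by apply: smooth_derivable; exact: smoothM.
apply: eq_bigr => -[j jr] _ /=; rewrite ltnS in jr.
rewrite (coef_pder _ _ _ (leq_ltn_trans jr rK)).
rewrite (coef_pder _ _ _ (leq_ltn_trans (leq_subr _ _) rK)).
rewrite (@deriveM _ _ (fun y => (f y)`_j) (fun y => (g y)`_(r - j)));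
  [|exact: smooth_derivable|exact: smooth_derivable].
by rewrite addrC /GRing.scale /= [_ * (g x)`_ _]mulrC.
Qed.

Lemma pderMl v c f x : psmooth f ->
  eqX (pder v (fun y => c * f y) x) (c * pder v f x).
Proof.
move=> sf; apply: eqX_trans (pderM _ _ (psmooth_cst c) sf) _.
by rewrite pder_cst mul0r add0r.
Qed.

Lemma pderN v f x : psmooth f ->
  eqX (pder v (fun y => - f y) x) (- pder v f x).
Proof.
move=> sf; have E : (fun y => - f y) =1 (fun y => -1 * f y).
  by move=> y; rewrite mulN1r.
by rewrite (eq_pder _ _ E); have := pderMl v (-1) x sf; rewrite mulN1r.
Qed.

Lemma pderB v f g x : psmooth f -> psmooth g ->
  eqX (pder v (fun y => f y - g y) x) (pder v f x - pder v g x).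
Proof.
move=> sf sg; rewrite pderD //; last exact: psmoothN.
by apply: eqXD => //; exact: pderN.
Qed.

Lemma pder_pform v n (B : 'M[R]_n) (F G : V -> 'I_n -> {poly R}) x :
  (forall p, psmooth (F ^~ p)) -> (forall p, psmooth (G ^~ p)) ->
  eqX (pder v (fun y => pform B (F y) (G y)) x)
      (pform B (fun p => pder v (F ^~ p) x) (G x)
       + pform B (F x) (fun p => pder v (G ^~ p) x)).
Proof.
move=> sF sG; have s1 p q : psmooth (fun y => (B p q)%:P * (F y p * G y q)).
  by apply: psmoothMl; exact: psmoothM.
rewrite pder_sum => [|p]; last by apply: psmooth_sum.
rewrite -big_split /=; apply: eqX_sum => p _; rewrite pder_sum //.
rewrite -big_split /=; apply: eqX_sum => q _.
rewrite -mulrDr; apply: eqX_trans (pderMl _ _ _ (psmoothM (sF p) (sG q))) _.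
by apply: eqXMl; exact: pderM.
Qed.

(** This is [schwarz] on each coefficient. Being an equality and not just a congruence, it supplies
    the symmetric second derivatives that [wedge_cocycle] asks for. *)
Lemma pderC u v f x : psmooth f -> pder u (pder v f) x = pder v (pder u f) x.
Proof.
move=> sf; apply/polyP => r; have [rK|Kr] := ltnP r K; last first.
  have Z w h y : (pder w h y)`_r = 0 by rewrite coef_poly ltnNge Kr.
  exact: etrans (Z _ _ _) (esym (Z _ _ _)).
have E w y : (pder w f y)`_r = 'D_w (fun z => (f z)`_r) y by exact: coef_pder.
apply: etrans (coef_pder _ _ _ rK) _; apply: etrans (eq_derive _ _ (E v)) _.
apply: etrans _ (esym (coef_pder _ _ _ rK)).
apply: etrans _ (esym (eq_derive _ _ (E u))).
exact: schwarz (sf r) _ _ _.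
Qed.

End PolyCalculus.

(** * The modified flow *)

Section ModifiedFlow.
Context {R : realType}.
Variables (n : nat) (U : 'rV[R]_n -> R).
Implicit Types (g : nat -> 'rV[R]_(n + n) -> 'rV[R]_n) (z : 'rV[R]_(n + n)).
Hypothesis sU : smooth U.

Lemma Dc0 g r z : Dc U g 0 r z = if r == 0%N then lsubmx z else 0.
Proof. by []. Qed.

Lemma Dc1 g r z : Dc U g 1 r z = if r == 0%N then rsubmx z else 0.
Proof. by []. Qed.

Lemma DcSS g m r z : Dc U g m.+2 r z =
  'D_(row_mx (rsubmx z) 0) (Dc U g m.+1 r) z
  + \sum_(a < r.+1) 'D_(row_mx 0 (Fc U g a z)) (Dc U g m.+1 (r - a)) z.
Proof. by []. Qed.

Local Opaque Dc derive.

Lemma smooth_id (V : normedModType R) : smooth (fun x : V => x).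
Proof.
move=> vs; elim/last_ind: vs => [|vs v _] x; first by [].
rewrite iterD_rcons; have -> : (fun x => 'D_v (fun y : V => y) x) = fun=> v.
  by apply/funext => y; exact: derive_id.
exact: smooth_cst.
Qed.

Lemma smooth_lsubmx : smooth (fun z => lsubmx z).
Proof. exact: (smooth_lin (@continuous_lsubmx _ _ _ _) (@smooth_id _)). Qed.

Lemma smooth_rsubmx : smooth (fun z => rsubmx z).
Proof. exact: (smooth_lin (@continuous_rsubmx _ _ _ _) (@smooth_id _)). Qed.

Lemma smooth_Fc g r : (forall i, smooth (g i)) -> smooth (Fc U g r).
Proof.
move=> sg; rewrite /Fc; case: (r == 0%N); last exact: sg.
apply/smooth_mxP => i j; rewrite (_ : (fun z => _) = fun z => 'D_(ev R j) U (lsubmx z)).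
  apply: (smooth_comp_lin (f := fun y => 'D_(ev R j) U y)); last exact: smooth_derive.
  exact: continuous_lsubmx.
by apply/funext => z; rewrite mxE.
Qed.

(* [flow g r] is the coefficient of [h^r] in the modified vector field. *)
Definition flow g r z : 'rV[R]_(n + n) :=
  row_mx (if r == 0%N then rsubmx z else 0) (Fc U g r z).

Lemma smooth_row_mx (f1 f2 : 'rV[R]_(n + n) -> 'rV[R]_n) :
  smooth f1 -> smooth f2 -> smooth (fun z => row_mx (f1 z) (f2 z)).
Proof.
move=> /smooth_mxP s1 /smooth_mxP s2; apply/smooth_mxP => i j.
have [k ->|k ->] := split_ordP j.
  by move: (s1 i k); congr smooth; apply/funext => z; rewrite row_mxEl.
by move: (s2 i k); congr smooth; apply/funext => z; rewrite row_mxEr.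
Qed.

Lemma smooth_Dc g : (forall i, smooth (g i)) -> forall m r, smooth (Dc U g m r).
Proof.
move=> sg; elim=> [|[|m] IH] r.
- rewrite (funext (Dc0 g r)).
  by case: (r == 0%N); [exact: smooth_lsubmx|exact: smooth_cst].
- rewrite (funext (Dc1 g r)).
  by case: (r == 0%N); [exact: smooth_rsubmx|exact: smooth_cst].
have sd q (w : 'rV[R]_(n + n) -> 'rV[R]_(n + n)) : smooth w ->
    smooth (fun z => 'D_(w z) (Dc U g m.+1 q) z).
  move=> sw; apply/smooth_mxP => i j.
  rewrite (_ : (fun z => _) = fun z => 'D_(w z) (fun y => Dc U g m.+1 q y i j) z).
    by apply: smooth_derive_along => //; move/smooth_mxP: (IH q).
  by apply/funext => z; rewrite derive_entry.
rewrite (funext (DcSS g m r)).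
apply: smoothD; first by apply/sd/smooth_row_mx; [exact: smooth_rsubmx|exact: smooth_cst].
apply: smooth_sum => a _; apply/sd/smooth_row_mx; first exact: smooth_cst.
exact: smooth_Fc.
Qed.

Lemma derive_dirD (V W : normedModType R) (f : V -> W) x u v : smooth f ->
  'D_(u + v) f x = 'D_u f x + 'D_v f x.
Proof. by move=> sf; rewrite !deriveE ?linearD //; exact: smooth_diff. Qed.

Lemma derive_Dc0 g e r z : 'D_e (Dc U g 0 r) z = if r == 0%N then lsubmx e else 0.
Proof.
rewrite (funext (Dc0 g r)); case: (r == 0%N); last exact: derive_cst.
by rewrite deriveE ?diff_lin //; [exact: continuous_lsubmx|exact: differentiable_lsubmx].
Qed.

Lemma derive_Dc1 g e r z : 'D_e (Dc U g 1 r) z = if r == 0%N then rsubmx e else 0.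
Proof.
rewrite (funext (Dc1 g r)); case: (r == 0%N); last exact: derive_cst.
by rewrite deriveE ?diff_lin //; [exact: continuous_rsubmx|exact: differentiable_rsubmx].
Qed.

(** One form of X D_m = D_(m+1) for all [m]. For [m = 0] it holds because D_0 = y has order 0 only;
    for larger [m], linearity in the direction merges the y' term of the definition into the summand
    [a = 0]. *)
Lemma Dc_succ g m r z : (forall i, smooth (g i)) ->
  Dc U g m.+1 r z = \sum_(a < r.+1) 'D_(flow g a z) (Dc U g m (r - a)) z.
Proof.
move=> sg; case: m => [|m].
  rewrite big_ord_recr /= subnn derive_Dc0 row_mxKl Dc1 big1 ?add0r // => a _.
  by rewrite derive_Dc0 subn_eq0 leqNgt ltn_ord.
apply: etrans (DcSS g m r z) _.
have sD q : smooth (Dc U g m.+1 q) by exact: smooth_Dc.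
pose T (a : nat) : 'rV[R]_n := 'D_(row_mx 0 (Fc U g a z)) (Dc U g m.+1 (r - a)) z.
pose S (a : nat) : 'rV[R]_n := 'D_(flow g a z) (Dc U g m.+1 (r - a)) z.
have S0 : S 0%N = 'D_(row_mx (rsubmx z) 0) (Dc U g m.+1 r) z + T 0%N.
  have F0 : flow g 0 z = row_mx (rsubmx z) 0 + row_mx 0 (Fc U g 0 z).
    by rewrite add_row_mx addr0 add0r.
  rewrite /S /T subn0 F0; exact: derive_dirD.
have ST a : S a.+1 = T a.+1 by [].
have mk (F : nat -> 'rV[R]_n) : \sum_(a < r.+1) F a = F 0%N + \sum_(a < r) F a.+1.
  exact: big_ord_recl.
apply: etrans (congr1 (+%R _) (mk T)) _; apply: etrans _ (esym (mk S)).
by rewrite S0 addrA; congr (_ + _); apply: eq_bigr => a _; rewrite ST.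
Qed.

(** The order-[r] coefficient of a derivative is built from forces of order at most [r]. This makes
    the recursion for the modified forces consistent. *)
Lemma Dc_local g g' m r : (forall a, (a <= r)%N -> g a = g' a) ->
  Dc U g m r = Dc U g' m r.
Proof.
elim: m r => [|[|m] IH] r gg; apply/funext => z.
- exact: etrans (Dc0 _ _ _) (esym (Dc0 _ _ _)).
- exact: etrans (Dc1 _ _ _) (esym (Dc1 _ _ _)).
apply: etrans (DcSS g m r z) _; apply: etrans _ (esym (DcSS g' m r z)).
apply: (congr2 +%R); first exact: (congr1 (fun f => 'D_ _ f z) (IH r gg)).
apply: eq_bigr => a _; have ar : (a <= r)%N by rewrite -ltnS ltn_ord.
apply: (congr2 (fun w f => 'D_(row_mx 0 w) f z)); first by rewrite /Fc (gg _ ar).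
by apply: IH => b br; apply: gg; exact: leq_trans br (leq_subr _ _).
Qed.

Variables (s : nat) (A : nat -> 'M[R]_n).

Lemma gtab_stable K i : (i <= K)%N -> gtab s A U K i = gmod s A U i.
Proof.
elim: K => [|K IH]; first by rewrite leqn0 => /eqP ->.
rewrite leq_eqVlt ltnS => /orP[/eqP -> //|iK] /=.
by rewrite ltn_eqF ?ltnS // IH.
Qed.

(** In [grhs] at order i+1 the derivatives are taken at order i+1-(2k-2) with k >= 2, hence below
    i+1, where the table already agrees with [gmod]. *)
Lemma gmodS i : gmod s A U i.+1 = grhs s A U (gmod s A U) i.+1.
Proof.
rewrite {1}/gmod /= eqxx; apply/funext => z; congr (- _).
rewrite !big_nat; apply: eq_bigr => k /andP[k2 _]; congr (_ *: mxv _ _).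
by rewrite (@Dc_local _ (gmod s A U)) // => a ai; apply: gtab_stable; lia.
Qed.

Lemma smooth_gtab K i : smooth (gtab s A U K i).
Proof.
elim: K i => [|K IH] i /=; first exact: smooth_cst.
case: (i == K.+1) => //; rewrite /grhs.
apply/smooth_mxP => p q.
rewrite (_ : (fun z => _) = fun z => - \sum_(2 <= k < i./2.+2) (2%:R / ((2 * k)`!)%:R) *
   \sum_j (Bk s A k q j * Dc U (gtab s A U K) (2 * k) (i - (2 * k - 2)) z 0 j)).
  apply: smoothN; apply: smooth_sum => k _; apply: smoothMl; apply: smooth_sum => j _.
  by apply: smoothMl; move/smooth_mxP: (smooth_Dc IH (2 * k) (i - (2 * k - 2))).
apply/funext => z; rewrite mxE summxE; congr (- _); apply: eq_bigr => k _.
rewrite !mxE; congr (_ * _); apply: eq_bigr => j _; by rewrite !mxE ord1.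
Qed.

Lemma smooth_gmod i : smooth (gmod s A U i).
Proof. exact: smooth_gtab. Qed.

Hypothesis A_consistent : \sum_(1 <= j < (s./2).+1) (j ^ 2)%:R *: A j = 1%:M.

Lemma Bk1 : Bk s A 1 = 1%:M.
Proof. by rewrite -A_consistent. Qed.

(** Coefficient of h^r in sum_k c_k h^(2k-2) B_k y^(2k) = grad U, with [k = l.+1]. The bound on [r]
    keeps all terms of that order within [L]. *)
Lemma flow_equation L r z : (r./2 < L)%N ->
  \sum_(l < L | (2 * l <= r)%N) (2%:R / (2 * l.+1)`!%:R) *:
     mxv (Bk s A l.+1) (Dc U (gmod s A U) (2 * l.+1) (r - 2 * l) z)
  = if r == 0%N then grad U (lsubmx z) else 0.
Proof.
move=> rL; pose G l := (2%:R / (2 * l.+1)`!%:R : R) *: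
     mxv (Bk s A l.+1) (Dc U (gmod s A U) (2 * l.+1) (r - 2 * l) z).
rewrite -(big_mkord (fun l => 2 * l <= r)%N G).
rewrite (@big_cat_nat _ _ _ r./2.+1) //= [X in _ + X]big_nat_cond [X in _ + X]big1 ?addr0; last first.
  by move=> l; lia.
have -> : \sum_(0 <= l < r./2.+1 | (2 * l <= r)%N) G l = \sum_(0 <= l < r./2.+1) G l.
  rewrite [RHS]big_nat big_nat_cond; apply: eq_bigl => l; lia.
rewrite big_nat_recl // {1}/G /= Bk1 muln1 subn0.
have -> : (2 / 2`!%:R : R) = 1 by rewrite divff // pnatr_eq0.
rewrite scale1r (_ : mxv _ _ = Dc U (gmod s A U) 2 r z); last first.
  by rewrite /mxv mul1mx trmxK.
(* The [l = 0] term is y''. As y' has order 0 only, just the last summand survives, and it is the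
   force at order [r]. *)
rewrite Dc_succ; last exact: smooth_gmod.
rewrite big_ord_recr /= subnn derive_Dc1 /= row_mxKr big1 ?add0r; last first.
  by move=> a _; rewrite derive_Dc1 subn_eq0 leqNgt ltn_ord.
case: r @G {rL} => [|r] G.
  by rewrite big_nil addr0.
(* At positive order the force is minus the remaining terms, by the recursion. *)
rewrite /Fc /= gmodS /grhs big_add1 /= big_add1 /=.
rewrite addrC; apply/eqP; rewrite subr_eq0; apply/eqP.
apply: eq_bigr => l _; rewrite /G.
have -> : (2 * l.+2 - 2 = 2 * l.+1)%N by lia.
reflexivity.
Qed.

End ModifiedFlow.

(** * The Ostrogradsky form and energy *)

(** The first term of index [j < l] pairs with the second term of index [j.+1]. For [x] = D and [y]
    = dD a pair is, up to sign, the differential of a product in [energy]; the unpaired ends are the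
    equation of motion term and half the differential of a square. *)
Lemma ostrogradsky_telescope (T : comNzRingType) (E : Type) (b : E -> E -> T)
    (x y : nat -> E) (l : nat) :
  \sum_(i < l.+1) (-1) ^+ i *
     (b (x i.+1) (y ((2 * l).+1 - i)%N) - b (y i) (x ((2 * l).+1 - i).+1))
  = - b (y 0%N) (x (2 * l).+2)
    - \sum_(j < l) (-1) ^+ j.+1 *
        (b (x j.+1) (y ((2 * l).+1 - j)%N) + b (y j.+1) (x ((2 * l).+1 - j)%N))
    - (-1) ^+ l.+1 * b (x l.+1) (y l.+1).
Proof.
under eq_bigr do rewrite mulrBr; rewrite sumrB big_ord_recr [X in _ - X]big_ord_recl /=.
have -> : ((2 * l).+1 - l = l.+1)%N by lia.
have -> : \sum_(j < l) (-1) ^+ j.+1 * (b (x j.+1) (y ((2 * l).+1 - j)%N) +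
      b (y j.+1) (x ((2 * l).+1 - j)%N)) =
    - (\sum_(j < l) (-1) ^+ j * b (x j.+1) (y ((2 * l).+1 - j)%N))
    + \sum_(j < l) (-1) ^+ (bump 0 j) * b (y (bump 0 j)) (x ((2 * l).+1 - bump 0 j).+1) :> T.
  rewrite -sumrN -big_split /=; apply: eq_bigr => j _.
  have -> : bump 0 j = j.+1 by [].
  have -> : (((2 * l).+1 - j.+1).+1 = (2 * l).+1 - j)%N by have := ltn_ord j; lia.
  by rewrite exprS; ring.
by rewrite subn0 expr0 exprS; ring.
Qed.

(** The cyclic sum behind d(dD_i^T B /\ dD_j) = 0. Once symmetry has ordered the second derivatives,
    six distinct terms remain, each with both signs. *)
Lemma wedge_cocycle (T : comNzRingType) (I E : Type) (b : E -> E -> T)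
    (d d' : I -> E) (d2 d2' : I -> I -> E) (x y z : I) :
  (forall e e', d2 e e' = d2 e' e) -> (forall e e', d2' e e' = d2' e' e) ->
  (b (d2 x z) (d' y) + b (d z) (d2' x y) - (b (d2 x y) (d' z) + b (d y) (d2' x z)))
  + (b (d2 y x) (d' z) + b (d x) (d2' y z) - (b (d2 y z) (d' x) + b (d z) (d2' y x)))
  + (b (d2 z y) (d' x) + b (d y) (d2' z x) - (b (d2 z x) (d' y) + b (d x) (d2' z y)))
  = 0.
Proof.
move=> C C'; rewrite (C y x) (C z x) (C z y) (C' y x) (C' z x) (C' z y).
move: (b (d2 x z) _) (b (d z) _) (b (d2 x y) _) (b (d y) _) (b (d x) _) (b (d2 y z) _).
by move=> p q r s t v; ring.
Qed.

Section FormalSymplectic.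
Context {R : realType}.
Variables (K L n m : nat).
Local Notation V := 'rV[R]_m.
Variables (D : nat -> V -> 'I_n -> {poly R}) (X : 'I_m -> V -> {poly R}).
Variables (w : nat -> {poly R}) (B : nat -> 'M[R]_n) (u : V -> R).
Local Notation eqX := (@eqX R K).
Local Notation pd e f z := (pder K (ev R e) f z).

Definition dcoord (e : 'I_m) k z p : {poly R} := pd e (D k ^~ p) z.

(* Coefficient at (a, e) of dD_i^T B_l /\ dD_j, where B_l is to be Bk (l+1); in
   the convention J zdot = grad H it sits in row e, column a. *)
Definition wedge l i j e a z : {poly R} :=
  pform (B l) (dcoord a i z) (dcoord e j z)
  - pform (B l) (dcoord e i z) (dcoord a j z).

(** With [k = l.+1], the range i < k and the index 2k-1-i of omega become [i < l.+1] and
    [(2 * l).+1 - i]. In [energy], [j.+1] stands for the index in 0 < j < k. *)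
Definition sform e a z : {poly R} :=
  \sum_(l < L) w l *
    \sum_(i < l.+1) (-1) ^+ i * wedge l i ((2 * l).+1 - i) e a z.

Definition energy z : {poly R} :=
  - (u z)%:P + \sum_(l < L) w l *
    (- \sum_(j < l) (-1) ^+ j.+1 *
         pform (B l) (D j.+1 z) (D ((2 * l).+1 - j) z)
     - (-1) ^+ l.+1 * (2^-1)%:P * pform (B l) (D l.+1 z) (D l.+1 z)).

Hypothesis sD : forall k p, psmooth (D k ^~ p).
Hypothesis su : smooth u.
Hypothesis B_sym : forall l, (l < L)%N -> (B l)^T = B l.

Lemma psmooth_dcoord e k p : psmooth (dcoord e k ^~ p).
Proof. exact: psmooth_pder. Qed.

Lemma psmooth_wedge l i j e a : psmooth (wedge l i j e a).
Proof. by apply: psmoothB; apply: psmooth_pform => p; exact: psmooth_dcoord. Qed.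

Lemma psmooth_sform_term l e a : psmooth (fun z =>
  \sum_(i < l.+1) (-1) ^+ i * wedge l i ((2 * l).+1 - i) e a z).
Proof.
by apply: psmooth_sum => i _; apply: psmoothMl; exact: psmooth_wedge.
Qed.

Lemma psmooth_sform e a : psmooth (sform e a).
Proof.
by apply: psmooth_sum => l _; apply: psmoothMl; exact: psmooth_sform_term.
Qed.

Lemma psmooth_energy_sum l : psmooth (fun z => \sum_(j < l) (-1) ^+ j.+1 *
         pform (B l) (D j.+1 z) (D ((2 * l).+1 - j) z)).
Proof.
by apply: psmooth_sum => j _; apply: psmoothMl; exact: psmooth_pform.
Qed.

Lemma psmooth_energy_term l : psmooth (fun z =>
    (- \sum_(j < l) (-1) ^+ j.+1 *
         pform (B l) (D j.+1 z) (D ((2 * l).+1 - j) z)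
     - (-1) ^+ l.+1 * (2^-1)%:P * pform (B l) (D l.+1 z) (D l.+1 z))).
Proof.
apply: psmoothB; first by apply: psmoothN; exact: psmooth_energy_sum.
by apply: psmoothMl; exact: psmooth_pform.
Qed.

Lemma psmooth_energy : psmooth energy.
Proof.
apply: psmoothD; first by apply: psmoothN; exact: psmoothC.
by apply: psmooth_sum => l _; apply: psmoothMl; exact: psmooth_energy_term.
Qed.

Lemma sform_skew e a z : sform e a z = - sform a e z.
Proof.
rewrite /sform -sumrN; apply: eq_bigr => l _; rewrite -mulrN -sumrN.
by congr (_ * _); apply: eq_bigr => i _; rewrite -mulrN opprB.
Qed.

Lemma pder_wedge l i j c e a z :
  eqX (pd c (wedge l i j e a) z)
   (pform (B l) (fun p => pd c (dcoord a i ^~ p) z) (dcoord e j z)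
    + pform (B l) (dcoord a i z) (fun p => pd c (dcoord e j ^~ p) z)
    - (pform (B l) (fun p => pd c (dcoord e i ^~ p) z) (dcoord a j z)
       + pform (B l) (dcoord e i z) (fun p => pd c (dcoord a j ^~ p) z))).
Proof.
apply: eqX_trans (pderB _ _ _ _) _.
- by apply: psmooth_pform => p; exact: psmooth_dcoord.
- by apply: psmooth_pform => p; exact: psmooth_dcoord.
by apply: eqXB; apply: pder_pform => p; exact: psmooth_dcoord.
Qed.

Lemma wedge_closed l i j a b c z :
  eqX (pd a (wedge l i j b c) z + pd b (wedge l i j c a) z
       + pd c (wedge l i j a b) z) 0.
Proof.
apply: eqX_trans (eqXD (eqXD (pder_wedge _ _ _ _ _ _ _)
  (pder_wedge _ _ _ _ _ _ _)) (pder_wedge _ _ _ _ _ _ _)) _.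
have C k e e' : (fun p => pd e (dcoord e' k ^~ p) z)
              = (fun p => pd e' (dcoord e k ^~ p) z).
  by apply/funext => p; exact: pderC.
apply: eq_eqX; exact: (wedge_cocycle (pform (B l)) (fun e => dcoord e i z)
  (fun e => dcoord e j z)
  (d2 := fun e e' p => pd e (dcoord e' i ^~ p) z)
  (d2' := fun e e' p => pd e (dcoord e' j ^~ p) z) a b c (C i) (C j)).
Qed.

Lemma pder_sform c e a z :
  eqX (pd c (sform e a) z)
   (\sum_(l < L) w l *
    \sum_(i < l.+1) (-1) ^+ i * pd c (wedge l i ((2 * l).+1 - i) e a) z).
Proof.
rewrite /sform pder_sum => [|l]; last by apply: psmoothMl; exact: psmooth_sform_term.
apply: eqX_sum => l _.
apply: eqX_trans (pderMl _ _ _ (psmooth_sform_term _ _ _)) _.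
apply: eqXMl; rewrite pder_sum => [|i]; last by apply: psmoothMl; exact: psmooth_wedge.
by apply: eqX_sum => i _; apply: pderMl; exact: psmooth_wedge.
Qed.

Lemma sform_closed a b c z :
  eqX (pd a (sform b c) z + pd b (sform c a) z + pd c (sform a b) z) 0.
Proof.
apply: eqX_trans (eqXD (eqXD (pder_sform _ _ _ _)
  (pder_sform _ _ _ _)) (pder_sform _ _ _ _)) _.
rewrite -!big_split /=; apply: eqX_sum0 => l _; rewrite -!mulrDr.
apply: eqX_mull0; rewrite -!big_split /=; apply: eqX_sum0 => i _.
rewrite -!mulrDr; apply: eqX_mull0.
exact: wedge_closed.
Qed.

(** The flow enters through two facts: X D_k = D_(k+1), and the equation of motion paired with
    dy. *)
Hypothesis D_flow : forall k p z,
  eqX (\sum_a pd a (D k ^~ p) z * X a z) (D k.+1 z p).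
Hypothesis D_eq : forall e z,
  eqX (\sum_(l < L) w l * pform (B l) (dcoord e 0 z) (D (2 * l).+2 z))
      (pd e (fun z => (u z)%:P) z).

Lemma wedge_contract l i j e z :
  eqX (\sum_a wedge l i j e a z * X a z)
      (pform (B l) (D i.+1 z) (dcoord e j z)
       - pform (B l) (dcoord e i z) (D j.+1 z)).
Proof.
under eq_bigr do rewrite mulrBl; rewrite sumrB.
apply: eqXB.
  apply: eqX_trans (eq_eqX (pform_suml _ (fun a => dcoord a i z) _ _)) _.
  by apply: eqX_pform => // p; exact: D_flow.
apply: eqX_trans (eq_eqX (pform_sumr _ _ (fun a => dcoord a j z) _)) _.
by apply: eqX_pform => // p; exact: D_flow.
Qed.

Lemma pder_energy e z : eqX (pd e energy z)
  (- pd e (fun z => (u z)%:P) z + \sum_(l < L) w l *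
    (- (\sum_(j < l) (-1) ^+ j.+1 *
       (pform (B l) (D j.+1 z) (dcoord e ((2 * l).+1 - j) z)
        + pform (B l) (dcoord e j.+1 z) (D ((2 * l).+1 - j) z)))
     - (-1) ^+ l.+1 * pform (B l) (D l.+1 z) (dcoord e l.+1 z))).
Proof.
rewrite /energy pderD; last 2 first.
- by apply: psmoothN; exact: psmoothC.
- by apply: psmooth_sum => l _; apply: psmoothMl; exact: psmooth_energy_term.
apply: eqXD; first by apply: pderN; exact: psmoothC.
rewrite pder_sum => [|l]; last by apply: psmoothMl; exact: psmooth_energy_term.
apply: eqX_sum => l _.
apply: eqX_trans (pderMl _ _ _ (psmooth_energy_term _)) _; apply: eqXMl.
apply: eqX_trans (pderB _ _ _ _) _.
- by apply: psmoothN; exact: psmooth_energy_sum.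
- by apply: psmoothMl; exact: psmooth_pform.
apply: eqXB.
  apply: eqX_trans (pderN _ _ (psmooth_energy_sum _)) _; apply: eqXN.
  rewrite pder_sum => [|j]; last by apply: psmoothMl; exact: psmooth_pform.
  apply: eqX_sum => j _; apply: eqX_trans (pderMl _ _ _ (psmooth_pform _ _ _)) _ => //.
  by apply: eqXMl; rewrite addrC; exact: pder_pform.
apply: eqX_trans (pderMl _ _ _ (psmooth_pform _ _ _)) _ => //.
rewrite -mulrA; apply: eqXMl.
(* Symmetry of [B l] makes the two halves of the derivative of the square equal; the factor 1/2
   leaves one of them. *)
have -> : pform (B l) (D l.+1 z) (dcoord e l.+1 z) = (2^-1)%:P *
   (pform (B l) (dcoord e l.+1 z) (D l.+1 z) + pform (B l) (D l.+1 z) (dcoord e l.+1 z)).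
  rewrite [pform _ (dcoord _ _ _) _]pformC ?B_sym //.
  have h2 : 2^-1 + 2^-1 = 1 :> R by lra.
  by rewrite mulrDr -mulrDl -polyCD h2 mul1r.
by apply: eqXMl; exact: pder_pform.
Qed.

(** [wedge_contract] turns the contraction into the alternating sum of [ostrogradsky_telescope]. By
    [D_eq] the end terms at [i = 0] add up to -dU, and the rest is the derivative of the other terms
    of [energy]. *)
Lemma sform_hamiltonian e z :
  eqX (\sum_a sform e a z * X a z) (pd e energy z).
Proof.
apply: eqX_trans _ (eqX_sym (pder_energy e z)).
apply: eqX_trans _ (eqXD (eqXN (D_eq e z)) (eqX_refl _)).
rewrite -sumrN -big_split /=.
have -> : \sum_a sform e a z * X a z = \sum_(l < L) w l *
    \sum_(i < l.+1) (-1) ^+ i *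
      \sum_a wedge l i ((2 * l).+1 - i) e a z * X a z.
  under eq_bigr do rewrite mulr_suml; rewrite exchange_big; apply: eq_bigr => l _.
  under eq_bigr do rewrite -mulrA mulr_suml; rewrite -mulr_sumr exchange_big.
  congr (_ * _); apply: eq_bigr => i _; rewrite mulr_sumr.
  by apply: eq_bigr => a _; rewrite mulrA.
apply: eqX_sum => l _; rewrite -mulrN -mulrDr; apply: eqXMl; rewrite !addrA.
rewrite -(ostrogradsky_telescope (pform (B l)) (D ^~ z) (fun k => dcoord e k z)).
by apply: eqX_sum => i _; apply: eqXMl; exact: wedge_contract.
Qed.

End FormalSymplectic.

(** * Estimates for polynomial linear systems *)

Section PolyEstimates.
Context {R : realType}.

Lemma horner_bounded (p : {poly R}) (h : R) : `|h| <= 1 ->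
  `|p.[h]| <= \sum_(i < size p) `|p`_i|.
Proof.
move=> h1; rewrite horner_coef (le_trans (ler_norm_sum _ _ _)) //.
apply: ler_sum => i _; rewrite normrM normrX ler_piMr //.
exact: exprn_ile1.
Qed.

(** Cramer's rule: the solution is adj(M) t / det M. Near h = 0 the determinant exceeds half its
    value at 0 in absolute value, and the numerator is polynomial in h, hence bounded for |h| <=
    1. *)
Lemma poly_system_bounded m (M : 'M[{poly R}]_m) (t : 'cV[{poly R}]_m) :
  (\det M)`_0 != 0 ->
  exists C d : R, [/\ 0 <= C, 0 < d & forall h : R, `|h| < d ->
    let Mh := map_mx (horner_eval h) M in
    Mh \in unitmx /\
    forall i, `|(invmx Mh *m map_mx (horner_eval h) t) i 0| <= C].
Proof.
set q := \det M => q0; set e := `|q`_0| / 2.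
have e0 : 0 < e by rewrite divr_gt0 // normr_gt0.
have cq : {for 0, continuous (horner q)} by exact: continuous_horner.
move/cvgrPdist_lt: cq => /(_ e e0) nq.
have /nbhs_ballP[d /= d0 dq] : nbhs (0 : R) (fun h => `|q.[0] - q.[h]| < e) by exact: nq.
pose v := \adj M *m t.
(* Summing the bounds of all components gives one constant; the radius is capped at 1 for
   [horner_bounded]. *)
exists (\sum_i e^-1 * \sum_(j < size (v i 0%R)) `|(v i 0)`_j|), (Num.min d 1).
split; first by apply: sumr_ge0 => i _; rewrite mulr_ge0 ?sumr_ge0 // invr_ge0 ltW.
  by rewrite lt_min d0 ltr01.
move=> h; rewrite lt_min => /andP[hd h1].
set Mh := map_mx (horner_eval h) M.
have qh : e < `|q.[h]|.
  have : ball 0 d h by rewrite -ball_normE /ball_ /= sub0r normrN.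
  move=> /dq; rewrite horner_coef0 => dist.
  have := ler_distD q.[h] q`_0 0; rewrite !subr0 => tri.
  have ee : `|q`_0| = e + e by rewrite -splitr.
  by rewrite ee in tri; lra.
have detMh : \det Mh = q.[h] by rewrite det_map_mx.
have qn0 : q.[h] != 0 by rewrite -normr_gt0 (lt_trans e0).
have uMh : Mh \in unitmx by rewrite unitmxE detMh unitfE.
split=> // i; rewrite /invmx uMh detMh -map_mx_adj -scalemxAl -map_mxM mxE [X in _ * X]mxE.
rewrite -/v normrM normfV.
apply: (@le_trans _ _ (e^-1 * \sum_(j < size (v i 0%R)) `|(v i 0)`_j|)).
  apply: ler_pM; rewrite ?invr_ge0 //.
    by rewrite lef_pV2 ?posrE ?normr_gt0 // ltW.
  by apply: horner_bounded; exact: ltW.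
rewrite (bigD1 i) //= lerDl sumr_ge0 // => k _.
by rewrite mulr_ge0 ?sumr_ge0 // invr_ge0 ltW.
Qed.

Lemma rV_norm_le m (x : 'rV[R]_m) (C : R) :
  0 <= C -> (forall i, `|x 0 i| <= C) -> `|x| <= C.
Proof.
move=> C0 xC; rewrite /Num.Def.normr /= mx_normrE; apply: bigmax_le => // -[i j] _.
by rewrite /= ord1.
Qed.

End PolyEstimates.

(** * Truncated series evaluated at a value of h *)

Section TruncatedSeries.
Context {R : realType}.
Variables (K : nat) (V : normedModType R).

Lemma derive_series (f : V -> {poly R}) (h : R) v x : psmooth f ->
  'D_v (fun y => \sum_(i < K) h ^+ i * (f y)`_i) x = (pder K v f x).[h].
Proof.
move=> sf; rewrite horner_poly.
have -> : (fun y => \sum_(i < K) h ^+ i * (f y)`_i) =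
    \sum_(i < K) (fun y => h ^+ i *: ((f y)`_i : R^o)).
  by apply/funext => y; rewrite fct_sumE.
rewrite derive_sum => [|i]; last by apply: derivableZ; exact: smooth_derivable.
apply: eq_bigr => i _; rewrite deriveZ; last exact: smooth_derivable.
exact: mulrC.
Qed.

Lemma psmooth_poly (f : nat -> V -> R) :
  (forall r, smooth (f r)) -> psmooth (fun x => \poly_(r < K) f r x).
Proof.
move=> sf r; have [rK|Kr] := ltnP r K.
  by move: (sf r); congr smooth; apply/funext => x; rewrite coef_poly rK.
move: (smooth_cst (V := V) (0 : R)); congr smooth.
by apply/funext => x; rewrite coef_poly ltnNge Kr.
Qed.

End TruncatedSeries.

(** * The series of the multistep method *)

Section MultistepSeries.
Context {R : realType}.
Variables (n s : nat) (A : nat -> 'M[R]_n) (U : 'rV[R]_n -> R) (N : nat).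
Hypothesis A_sym : forall j, (1 <= j <= s./2)%N -> (A j)^T = A j.
Hypothesis A_consistent : \sum_(1 <= j < (s./2).+1) (j ^ 2)%:R *: A j = 1%:M.
Hypothesis sU : smooth U.
Local Notation V := 'rV[R]_(n + n).
Local Notation K := N.+1.
Local Notation L := N./2.+1.
Local Notation g := (gmod s A U).
Local Notation pd e f z := (pder K (ev R e) f z).

Definition Dser k (z : V) p : {poly R} := \poly_(r < K) (Dc U g k r z) 0 p.
Definition Fser a (z : V) : {poly R} := \poly_(r < K) (flow U g r z) 0 a.
(** The factor c_k h^(2k-2) for [k = l.+1]. The range [l < N./2.+1] contains every [l] with
    [2 * l <= N], which suffices modulo ['X^(N.+1)]. *)
Definition weight l : {poly R} := (2%:R / (2 * l.+1)`!%:R)%:P * 'X^(2 * l).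
Definition Bser l := Bk s A l.+1.
Definition pot (z : V) : R := U (lsubmx z).

Let sDc k r p : smooth (fun z => (Dc U g k r z) 0 p).
Proof. by have /smooth_mxP := smooth_Dc sU (smooth_gmod sU s A) k r. Qed.

Lemma psmooth_Dser k p : psmooth (Dser k ^~ p).
Proof. exact: (psmooth_poly K (fun r => sDc k r p)). Qed.

Lemma smooth_pot : smooth pot.
Proof. by apply: (smooth_comp_lin (f := U)) => //; exact: continuous_lsubmx. Qed.

Lemma Bser_sym l : (Bser l)^T = Bser l.
Proof.
rewrite /Bser /Bk raddf_sum big_nat [RHS]big_nat; apply: eq_bigr => j jr.
by rewrite /= linearZ /= A_sym.
Qed.

Lemma coef_Dser k z p r : (r < K)%N -> (Dser k z p)`_r = (Dc U g k r z) 0 p.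
Proof. by move=> rK; rewrite coef_poly rK. Qed.

Lemma coef_dcoord e k z p r : (r < K)%N ->
  (dcoord K Dser e k z p)`_r = ('D_(ev R e) (Dc U g k r) z) 0 p.
Proof.
move=> rK; apply: etrans (coef_pder _ _ _ rK) _.
apply: etrans (eq_derive _ _ (fun y => coef_Dser k y p rK)) _.
by apply/esym; apply: derive_entry; exact: (smooth_Dc sU (smooth_gmod sU s A)).
Qed.

(** Coefficientwise this is [Dc_succ], with the derivative along [flow] expanded in partial
    derivatives and the sum over orders read as a product of series. *)
Lemma Dser_flow k p z :
  eqX K (\sum_a pd a (Dser k ^~ p) z * Fser a z) (Dser k.+1 z p).
Proof.
move=> r rK; rewrite coef_sum coef_Dser //.
apply: etrans _ (esym (congr1 (fun M : 'rV[R]_n => M 0 p) (Dc_succ sU k r z (smooth_gmod sU s A)))).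
rewrite summxE; under eq_bigr do rewrite coefMr.
rewrite exchange_big /=; apply: eq_bigr => j _.
have jr : (j <= r)%N by rewrite -ltnS ltn_ord.
have rjK := leq_ltn_trans (leq_subr j r) rK.
have jK := leq_ltn_trans jr rK.
have sD := smooth_Dc sU (smooth_gmod sU s A) k (r - j).
apply: etrans _ (esym (congr1 (fun M : 'rV[R]_n => M 0 p) (derive_row_sum z (flow U g j z) sD))).
rewrite summxE; apply: eq_bigr => a _.
apply: etrans (congr2 *%R (coef_dcoord a k z p rjK) _) _.
  by rewrite coef_poly jK.
by rewrite [RHS]mxE mulrC.
Qed.

Lemma dcoord0 e z p : eqX K (dcoord K Dser e 0 z p) ((lsubmx (ev R e)) 0 p)%:P.
Proof.
move=> r rK; rewrite coef_dcoord // derive_Dc0 coefC.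
by case: (r == 0%N); rewrite ?mxE.
Qed.

Lemma coef_weight_mul l p r :
  (weight l * p)`_r = if (r < 2 * l)%N then 0
                      else (2%:R / (2 * l.+1)`!%:R) * p`_(r - 2 * l).
Proof.
rewrite /weight -[_ * _ * p]mulrA coefCM coefXnM.
by case: ifP => //; rewrite mulr0.
Qed.

Lemma pd_pot e z :
  eqX K (pd e (fun z => (pot z)%:P) z)
        (\sum_p (lsubmx (ev R e)) 0 p * grad U (lsubmx z) 0 p)%:P.
Proof.
move=> r rK; apply: etrans (coef_pder _ _ _ rK) _.
rewrite coefC; case: r {rK} => [|r] /=; last first.
  rewrite -[RHS](derive_cst (0 : R) z (ev R e)); apply: eq_derive => y.
  by rewrite coefC.
rewrite (@eq_derive _ _ _ pot) => [|y]; last by rewrite coefC.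
rewrite /pot (derive_comp_lin (f := U)); last exact: smooth_diff; last first.
  exact: continuous_lsubmx.
rewrite derive_row_sum //; apply: eq_bigr => p _.
by congr (_ * _); rewrite mxE.
Qed.

(** This is [flow_equation] paired with dy. Since D_0 = y carries no power of h, its differential is
    constant in h and does not mix orders. *)
Lemma Dser_equation e z :
  eqX K (\sum_(l < L) weight l *
           pform (Bser l) (dcoord K Dser e 0 z) (Dser (2 * l).+2 z))
        (pd e (fun z => (pot z)%:P) z).
Proof.
set c := fun p => (lsubmx (ev R e)) 0 p.
apply: (@eqX_trans _ _ (\sum_(l < L) weight l *
    pform (Bser l) (fun p => (c p)%:P) (Dser (2 * l.+1) z))).
  apply: eqX_sum => l _; apply: eqXMl; rewrite mulnS add2n.
  by apply: eqX_pform => // p; exact: dcoord0.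
apply: eqX_trans _ (eqX_sym (pd_pot e z)) => r rK.
have rL : (r./2 < L)%N by rewrite ltnS half_leq.
have := flow_equation sU A_consistent z rL.
set F := \sum_(l < L | _) _ => EF.
rewrite coef_sum; transitivity (\sum_p c p * F 0 p); last first.
  rewrite EF coefC; case: (r == 0%N) => //.
  by apply: big1 => p _; rewrite mxE mulr0.
rewrite [RHS](eq_bigr (fun p => \sum_(l < L | (2 * l <= r)%N) c p *
  ((2%:R / (2 * l.+1)`!%:R) * mxv (Bser l) (Dc U g (2 * l.+1) (r - 2 * l) z) 0 p))); last first.
  move=> p _; rewrite /F summxE mulr_sumr; apply: eq_bigr => l _.
  by congr (_ * _); rewrite mxE.
rewrite exchange_big /= [RHS]big_mkcond; apply: eq_bigr => l _.
rewrite coef_weight_mul ltnNge; case: (2 * l <= r)%N => //=.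
have rlK := leq_ltn_trans (leq_subr (2 * l) r) rK.
rewrite coef_sum mulr_sumr; apply: eq_bigr => p _.
rewrite mulrCA; congr (_ * _); rewrite coef_sum /mxv mxE mxE mulr_sumr.
apply: eq_bigr => q _; rewrite !coefCM coef_Dser // mulrCA.
by congr (_ * (_ * _)); rewrite mxE.
Qed.

Local Notation Jser e a z := (sform K L Dser weight Bser e a z).
Local Notation Hser z := (energy L Dser weight Bser pot z).

(** Summands with [l > 0] start at order [2 * l], and c_1 = 2/2! = 1. *)
Lemma coef0_weight_sum (T : nat -> {poly R}) :
  (\sum_(l < L) weight l * T l)`_0 = (T 0%N)`_0.
Proof.
rewrite big_ord_recl coefD coef_sum big1 => [|l _]; last by rewrite coef_weight_mul.
rewrite addr0 coef_weight_mul /= muln1.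
by have -> : (2 / 2`!%:R : R) = 1 by [rewrite divff // pnatr_eq0]; rewrite mul1r.
Qed.

Lemma Bser0 : Bser 0 = 1%:M.
Proof. exact: Bk1 A_consistent. Qed.

Lemma pform1 (u v : 'I_n -> {poly R}) : pform 1%:M u v = \sum_p u p * v p.
Proof.
apply: eq_bigr => p _; rewrite (bigD1 p) //= mxE eqxx mul1r big1 ?addr0 // => q qp.
by rewrite mxE eq_sym (negbTE qp) mul0r.
Qed.

Lemma coef0_pform (u v : 'I_n -> {poly R}) :
  (pform (Bser 0) u v)`_0 = \sum_p (u p)`_0 * (v p)`_0.
Proof.
by rewrite Bser0 pform1 coef_sum; apply: eq_bigr => p _; rewrite coef0M.
Qed.

Lemma coef0_wedge e a z :
  (wedge K Dser Bser 0 0 1 e a z)`_0 =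
  \sum_p ((lsubmx (ev R a)) 0 p * (rsubmx (ev R e)) 0 p
        - (lsubmx (ev R e)) 0 p * (rsubmx (ev R a)) 0 p).
Proof.
have d0 a' p : (dcoord K Dser a' 0 z p)`_0 = (lsubmx (ev R a')) 0 p.
  by rewrite coef_dcoord // derive_Dc0.
have d1 a' p : (dcoord K Dser a' 1 z p)`_0 = (rsubmx (ev R a')) 0 p.
  by rewrite coef_dcoord // derive_Dc1.
rewrite sumrB; apply: etrans (coefB _ _ _) _; apply: (congr2 (fun x y => x - y)).
  apply: etrans (coef0_pform _ _) _; apply: eq_bigr => p _.
  exact: (congr2 *%R (d0 a p) (d1 e p)).
apply: etrans (coef0_pform _ _) _; apply: eq_bigr => p _.
exact: (congr2 *%R (d0 e p) (d1 a p)).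
Qed.

(** At order 0 only [l = 0], [i = 0] remains, which is dy /\ dy'. In the row and column convention
    of [wedge], its four blocks are those of [Jcan]. *)
Lemma coef0_sform e a z : (Jser e a z)`_0 = Jcan R n e a.
Proof.
apply: etrans (coef0_weight_sum (fun l => \sum_(i < l.+1) (-1) ^+ i *
  wedge K Dser Bser l i ((2 * l).+1 - i) e a z)) _.
rewrite big_ord_recl big_ord0 addr0 expr0 mul1r; apply: etrans (coef0_wedge _ _ _) _.
have dl i p : (lsubmx (ev R (lshift n i) : V)) 0 p = (p == i)%:R.
  by rewrite !mxE eqxx /= eq_lshift.
have dr i p : (rsubmx (ev R (rshift n i) : V)) 0 p = (p == i)%:R.
  by rewrite !mxE eqxx /= eq_rshift.
have dlr i p : (lsubmx (ev R (rshift n i) : V)) 0 p = 0.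
  by rewrite !mxE eqxx /= eq_lrshift.
have drl i p : (rsubmx (ev R (lshift n i) : V)) 0 p = 0.
  by rewrite !mxE eqxx /= eq_rlshift.
have S i j : \sum_(p < n) (p == i)%:R * (p == j)%:R = (i == j)%:R :> R.
  rewrite (bigD1 i) //= eqxx mul1r big1 ?addr0 // => p /negbTE ->.
  by rewrite mul0r.
rewrite /Jcan; have [i ->|i ->] := split_ordP e; have [j ->|j ->] := split_ordP a.
- rewrite block_mxEul mxE big1 // => p _; by rewrite !drl !mulr0 subr0.
- rewrite block_mxEur !mxE -S -sumrN; apply: eq_bigr => p _.
  by rewrite dl dr drl mulr0 sub0r.
- rewrite block_mxEdl mxE eq_sym -S; apply: eq_bigr => p _.
  by rewrite dl dr dlr mul0r subr0.
- rewrite block_mxEdr mxE big1 // => p _; by rewrite !dlr !mul0r subr0.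
Qed.

Lemma coef0_energy z : (Hser z)`_0 = Ham U z.
Proof.
apply: etrans (coefD _ _ _) _.
rewrite (coef0_weight_sum (fun l => - \sum_(j < l) (-1) ^+ j.+1 *
    pform (Bser l) (Dser j.+1 z) (Dser ((2 * l).+1 - j) z)
  - (-1) ^+ l.+1 * (2^-1)%:P * pform (Bser l) (Dser l.+1 z) (Dser l.+1 z))).
rewrite coefN coefC /= /Ham addrC; congr (_ - _).
have D1 p : (Dser 1 z p)`_0 = rsubmx z 0 p by rewrite coef_Dser // Dc1.
(* For [l = 0] the sum over [j] is empty, and two minus signs cancel to leave half the square of
   y'. *)
rewrite big_ord0 oppr0 sub0r expr1 mulN1r mulNr opprK coefCM coef0_pform.
by congr (_ * _); apply: eq_bigr => p _; rewrite D1 expr2.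
Qed.

Lemma Fmod_series h z a : Fmod s A U N h z 0 a = (Fser a z).[h].
Proof.
rewrite horner_poly; have -> : Fmod s A U N h z = \sum_(r < K) h ^+ r *: flow U g r z.
  rewrite /flow big_ord_recl /= expr0 scale1r /Fmod big_add1 /= big_mkord.
  have -> : \sum_(i < N) h ^+ bump 0 i *: row_mx 0 (Fc U g (bump 0 i) z)
      = row_mx 0 (\sum_(i < N) h ^+ i.+1 *: g i.+1 z) :> V.
    elim/big_ind2: _ => [|x1 x2 y1 y2 -> ->|i _]; first by rewrite row_mx0.
      by rewrite add_row_mx addr0.
    by rewrite scale_row_mx scaler0.
  by rewrite add_row_mx addr0.
by rewrite summxE; apply: eq_bigr => r _; rewrite mxE mulrC.
Qed.

End MultistepSeries.

(** * Truncation in h *)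

Section Truncation.
Context {R : realType}.
Variables (N m : nat).
Local Notation V := 'rV[R]_m.
Local Notation K := N.+1.
Variables (J : 'I_m -> 'I_m -> V -> {poly R}) (H : V -> {poly R}).
Local Notation pd e f z := (pder K (ev R e) f z).

Definition Jcoef i z : 'M[R]_m := \matrix_(e, a) (J e a z)`_i.
Definition Hcoef i z : R := (H z)`_i.
Definition Jtrunc h z : 'M[R]_m := \sum_(i < K) h ^+ i *: Jcoef i z.
Definition Htrunc h z : R := \sum_(i < K) h ^+ i * Hcoef i z.

Hypothesis sJ : forall e a, psmooth (J e a).
Hypothesis sH : psmooth H.

Lemma smooth_Jcoef i : smooth (Jcoef i).
Proof.
apply/smooth_mxP => e a; move: (sJ e a i); congr smooth.
by apply/funext => z; rewrite mxE.
Qed.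

Lemma JtruncE h z e a : Jtrunc h z e a = \sum_(i < K) h ^+ i * (J e a z)`_i.
Proof. by rewrite summxE; apply: eq_bigr => i _; rewrite !mxE. Qed.

Lemma Jtrunc_skew h : (forall e a z, J e a z = - J a e z) -> skew_field (Jtrunc h).
Proof.
move=> skew z; apply/matrixP => e a; rewrite mxE [RHS]mxE !JtruncE -sumrN.
by apply: eq_bigr => i _; rewrite skew coefN mulrN.
Qed.

Lemma derive_Jtrunc h z b c v :
  'D_v (fun y => Jtrunc h y b c) z = (pder K v (J b c) z).[h].
Proof.
rewrite (_ : (fun y => _) = fun y => \sum_(i < K) h ^+ i * (J b c y)`_i).
  exact: derive_series.
by apply/funext => y; rewrite JtruncE.
Qed.

(** The congruence settles the coefficients below [K], and those from [K] on vanish by the cut in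
    [pder]. Hence the truncated form is exactly closed for every h. *)
Lemma Jtrunc_closed h :
  (forall a b c z, eqX K (pd a (J b c) z + pd b (J c a) z + pd c (J a b) z) 0) ->
  closed_form (Jtrunc h).
Proof.
move=> closed z a b c.
apply: etrans (congr2 +%R (congr2 +%R (derive_Jtrunc h z b c (ev R a))
  (derive_Jtrunc h z c a (ev R b))) (derive_Jtrunc h z a b (ev R c))) _.
rewrite -!hornerD; set p := (_ + _).
suff -> : p = 0 by rewrite horner0.
apply/polyP => r; rewrite coef0; have [rK|Kr] := ltnP r K.
  by rewrite (closed a b c z r rK) coef0.
have Z v f : (pder K v f z)`_r = 0 by rewrite coef_poly ltnNge Kr.
apply: etrans (coefD _ _ _) _; apply: etrans (congr2 +%R (coefD _ _ _) (Z _ _)) _.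
by apply: etrans (congr2 +%R (congr2 +%R (Z _ _) (Z _ _)) (erefl _)) _; rewrite !addr0.
Qed.

Lemma grad_Htrunc h z e : grad (Htrunc h) z 0 e = (pd e H z).[h].
Proof. by rewrite mxE; exact: derive_series. Qed.

Variables (X : 'I_m -> V -> {poly R}).

(* [J X = grad H] modulo [h^K]; the error of [J^-1 (grad H)] against [X] is
   therefore [h^K (det J)^-1 (adj J) t] for a vector [t] polynomial in [h]. *)
Lemma hamiltonian_field_bound z (F : R -> V) :
  (forall e, eqX K (\sum_a J e a z * X a z) (pd e H z)) ->
  (forall h a, F h 0 a = (X a z).[h]) ->
  \det (Jcoef 0 z) != 0 ->
  exists C d : R, 0 < d /\ forall h, `|h| < d ->
    `|mxv (invmx (Jtrunc h z)) (grad (Htrunc h) z) - F h| <= C * `|h| ^+ K.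
Proof.
move=> JX FX det0.
(* [M] keeps the terms of [J] below order [K]: its value at h is [Jtrunc h z], and M X still agrees
   with grad H below order [K], so that [rest] is ['X^K] times a polynomial vector [t]. *)
pose M : 'M[{poly R}]_m := \matrix_(e, a) \poly_(r < K) (J e a z)`_r.
pose rest e : {poly R} := pd e H z - \sum_a M e a * X a z.
pose t : 'cV[{poly R}]_m := \col_e drop_poly K (rest e).
have restE e : rest e = t e 0 * 'X^K.
  rewrite mxE -[LHS](poly_take_drop K) -[RHS]add0r; congr (_ + _).
  apply/polyP => r; rewrite coef_take_poly coef0; case: ifP => // rK.
  rewrite coefB -(JX e r rK) !coef_sum -sumrB big1 // => a _; apply/eqP.
  rewrite subr_eq0; apply/eqP; move: r rK; apply: eqXM => // r rK.
  by rewrite mxE coef_poly rK.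
have Mh h : map_mx (horner_eval h) M = Jtrunc h z.
  apply/matrixP => e a; rewrite JtruncE !mxE /horner_eval horner_poly.
  by apply: eq_bigr => i _; rewrite mulrC.
have detM : (\det M)`_0 != 0.
  rewrite -horner_coef0 -[_.[0]]/(horner_eval 0 _) -det_map_mx Mh.
  suff -> : Jtrunc 0 z = Jcoef 0 z by [].
  rewrite /Jtrunc big_ord_recl expr0 scale1r big1 ?addr0 // => i _.
  by rewrite expr0n scale0r.
have [C [d [C0 d0 Cd]]] := poly_system_bounded t detM.
exists C, d; split=> // h /Cd [uM tC]; rewrite Mh in uM tC.
have E : mxv (invmx (Jtrunc h z)) (grad (Htrunc h) z) - F h =
    h ^+ K *: (invmx (Jtrunc h z) *m map_mx (horner_eval h) t)^T.
  rewrite /mxv; apply: trmx_inj; rewrite linearB linearZ /= !trmxK.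
  (* Writing [F h] as J^-1 (J F h) factors the inverse out and leaves the value of [rest] at h. *)
  rewrite -{1}[(F h)^T](mulKmx uM) -mulmxBr scalemxAr; congr (_ *m _).
  apply/matrixP => e j; rewrite ord1 {j}.
  transitivity (rest e).[h]; last first.
    by rewrite restE hornerM hornerXn !mxE mulrC.
  rewrite /rest hornerD hornerN horner_sum.
  apply: etrans (mxE _ _ _ _) _; apply: (congr2 +%R).
    by rewrite mxE; exact: grad_Htrunc.
  rewrite mxE; congr (- _); rewrite mxE; apply: eq_bigr => a _.
  rewrite hornerM -Mh; congr (_ * _); first by rewrite mxE.
  by rewrite mxE FX.
rewrite E normrZ normrX mulrC; apply: ler_wpM2r; first exact: exprn_ge0.
by apply: rV_norm_le => // i; rewrite mxE.
Qed.

End Truncation.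

(** [Jcan] squares to minus the identity. *)
Lemma Jcan_unit (R : realType) n : Jcan R n \in unitmx.
Proof.
apply: (proj1 (mulmx1_unit (_ : Jcan R n *m - Jcan R n = 1%:M))).
rewrite /Jcan mulmxN mulmx_block !mul0mx !mulmx0 !mulmx1 ?mulNmx ?mul1mx.
rewrite !add0r !addr0 opp_block_mx !opprK !oppr0.
by rewrite -scalar_mx_block.
Qed.

Theorem theorem2p2 (R : realType) (n s : nat) (A : nat -> 'M[R]_n)
  (U : 'rV[R]_n -> R) (N : nat) :
  ~~ odd s ->
  (forall j, (1 <= j <= s./2)%N -> (A j)^T = A j) ->
  \sum_(1 <= j < (s./2).+1) (j ^ 2)%:R *: A j = 1%:M ->
  smooth U ->
  exists (Jc : nat -> 'rV[R]_(n + n) -> 'M[R]_(n + n))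
         (Hc : nat -> 'rV[R]_(n + n) -> R),
    let Jmod := fun (h : R) z => \sum_(i < N.+1) h ^+ i *: Jc i z in
    let Hmod := fun (h : R) z => \sum_(i < N.+1) h ^+ i * Hc i z in
    [/\ (forall i, smooth (Jc i)) /\ (forall i, smooth (Hc i)),
        Jc 0%N = (fun _ => Jcan R n) /\ Hc 0%N = Ham U,
        (forall h, skew_field (Jmod h) /\ closed_form (Jmod h)) &
        forall z, exists C d : R, 0 < d /\
          forall h : R, `|h| < d ->
            `| mxv (invmx (Jmod h z)) (grad (Hmod h) z) - Fmod s A U N h z |
              <= C * `|h| ^+ N.+1 ].
Proof.
move=> _ A_sym A_consistent sU.
pose D := Dser s A U N; pose B := Bser s A; pose w := @weight R.
pose J := sform N.+1 N./2.+1 D w B; pose H := energy N./2.+1 D w B (pot U).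
have sD k p : psmooth (D k ^~ p) by exact: psmooth_Dser.
have sP : smooth (pot U) by exact: smooth_pot.
have sJ e a : psmooth (J e a) by exact: psmooth_sform.
have sH : psmooth H by exact: psmooth_energy.
have J0 z : Jcoef J 0 z = Jcan R n.
  by apply/matrixP => e a; rewrite mxE; exact: coef0_sform.
exists (Jcoef J), (Hcoef H); split.
- by split; [exact: smooth_Jcoef|exact: sH].
- split; apply/funext => z; first exact: J0.
  exact: coef0_energy.
- move=> h; split.
    by apply: Jtrunc_skew => e a z; exact: sform_skew.
  by apply: Jtrunc_closed => // a b c z; exact: sform_closed.
move=> z; apply: (@hamiltonian_field_bound _ _ _ J H sH (Fser s A U N) z
  (fun h => Fmod s A U N h z)).
- move=> e; apply: sform_hamiltonian => //.
  + by move=> l _; exact: Bser_sym.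
  + exact: Dser_flow.
  + exact: Dser_equation.
- by move=> h a; exact: Fmod_series.
by rewrite J0 -unitfE -unitmxE; exact: Jcan_unit.
Qed.
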